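(* Let $G$ be a finite simple cubic (3-regular) graph that has no subgraph (not necessarily induced) isomorphic to the graph $L$. Then $V(G)$ can be partitioned into two total dominating sets; equivalently, there is a partition $V(G)=S_1\cup S_2$, $S_1\cap S_2=\emptyset$, such that every vertex of $G$ has at least one neighbor in $S_1$ and at least one neighbor in $S_2$. In other words, the total domatic number $d_t(G)$ (equivalently, the coupon coloring number of $G$) is at least $2$.
   Context: All graphs are finite and simple. A total dominating set of a graph $G$ is a set $T\subseteq V(G)$ such that every vertex $v\in V(G)$ is adjacent to at least one vertex of $T$. The total domatic number $d_t(G)$ is the maximum number of pairwise disjoint total dominating sets whose union is $V(G)$. The graph $L$ is the tree on $10$ vertices consisting of a central vertex $c$ adjacent to three vertices $x_1,x_2,x_3$, where each $x_i$ is further adjacent to two leaves $y_{i,1},y_{i,2}$ (all ten vertices distinct; $9$ edges). *)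

(* Defs.v *)
From mathcomp Require Import all_boot.
Set Implicit Arguments. Unset Strict Implicit. Unset Printing Implicit Defensive.

Definition simple_graph (T : finType) (e : rel T) : Prop :=
  symmetric e /\ irreflexive e.

Definition nbhd (T : finType) (e : rel T) (x : T) : {set T} := [set y | e x y].

Definition cubic (T : finType) (e : rel T) : Prop :=
  forall x : T, #|nbhd e x| = 3.

Definition total_dominating (T : finType) (e : rel T) (D : {set T}) : Prop :=
  forall v : T, exists2 u, u \in D & e v u.

(* The tree L on vertices 'I_10: centre 0, x_i = 1,2,3,
   leaves of x_1: 4,5; of x_2: 6,7; of x_3: 8,9. *)
Definition L_edge0 (a b : nat) : bool :=
  [|| (a == 0) && ((b == 1) || (b == 2) || (b == 3)),
      (a == 1) && ((b == 4) || (b == 5)),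
      (a == 2) && ((b == 6) || (b == 7)) |
      (a == 3) && ((b == 8) || (b == 9))].

Definition L_adj : rel 'I_10 :=
  fun a b => L_edge0 a b || L_edge0 b a.

Definition has_L_subgraph (T : finType) (e : rel T) : Prop :=
  exists f : 'I_10 -> T, injective f /\ forall a b, L_adj a b -> e (f a) (f b).

(* Main.v *)
(* A vertex that is the centre of no copy of L lies on a triangle or on a
   four-cycle.  The colouring is built on vertex sets closed under having a
   common neighbour, one such set at a time.
   If a, b, c, d is a four-cycle, a counting argument gives a permutation m with
   m v adjacent to v, m a = b and m c = d.  Colouring b and d differently
   splits the neighbourhoods of a and c, and the colouring then spreads
   greedily: a new vertex u takes the colour opposite to that of a coloured
   neighbour of the vertex matched to u.
   If no vertex lies on a four-cycle, the triangles partition the vertices and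
   the colouring spreads from triangle to triangle. *)
Require Import Defs.
From mathcomp Require Import all_boot zify.
Set Implicit Arguments. Unset Strict Implicit. Unset Printing Implicit Defensive.

(** * Finite sets: growth to a maximal set and Hall's theorem *)

Lemma card_setI2 (T : finType) (A : {set T}) (x y : T) :
  x != y -> #|A :&: [set x; y]| = (x \in A) + (y \in A).
Proof.
move=> nxy; rewrite setIC setIUl cardsU.
have -> : [set x] :&: A :&: ([set y] :&: A) = set0.
  apply/setP=> z; rewrite !inE; apply/negP=> /andP[/andP[/eqP-> _]].
  by rewrite (negPf nxy).
have card1 z : #|[set z] :&: A| = (z \in A).
  case: (boolP (z \in A)) => zA.
    by rewrite (setIidPl _) ?cards1 // sub1set.
  by apply/eqP; rewrite cards_eq0 setI_eq0 disjoints1.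
by rewrite cards0 subn0 !card1.
Qed.

(** Each enlargement shrinks the complement, so growth stops, and it can stop only at a set with
    [G]. The greedy colourings below run through this lemma, with [G] as the stopping condition. *)
Lemma maximal_extension (T : finType) (Q G : {set T} -> Prop) :
  (forall A, Q A -> G A \/ exists B : {set T}, Q B /\ A \proper B) ->
  forall A, Q A -> exists B : {set T}, [/\ A \subset B, Q B & G B].
Proof.
move=> step A; move: {2}#|~: A| (leqnn #|~: A|) => n.
elim: n A => [|n IHn] A leAn QA; case: (step _ QA) => [GA|[B [QB ltAB]]].
- by exists A.
- by have := proper_card ltAB; have := cardsC A; have := cardsC B; lia.
- by exists A.
have leBn : #|~: B| <= n.
  by have := proper_card ltAB; have := cardsC A; have := cardsC B; lia.
have [C [BC QC GC]] := IHn _ leBn QB.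
by exists C; split=> //; apply: subset_trans BC; apply: proper_sub.
Qed.

(* Rado's argument: if a member of the family has two distinct elements,
   submodularity shows that deleting one of them preserves Hall's condition. *)
Lemma hall (I T : finType) (F : I -> {set T}) :
  (forall X : {set I}, #|X| <= #|\bigcup_(i in X) F i|) ->
  exists2 m : I -> T, injective m & forall i, m i \in F i.
Proof.
have [n] := ubnP (\sum_i #|F i|); elim: n F => // n IHn F leFn hallF.
have [/existsP[i] | /existsPn small] := boolP [exists i, 1 < #|F i|].
  case/card_gt1P=> x [y [xFi yFi nxy]].
  pose F' z j := if j == i then F i :\ z else F j.
  have IHF z : z \in F i ->
      (exists2 m : I -> T, injective m & forall i, m i \in F i) \/
      exists2 X : {set I}, i \in X & #|\bigcup_(j in X) F' z j| < #|X|.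
    move=> zFi.
    have [/forallP hallF'|] :=
        boolP [forall X : {set I}, #|X| <= #|\bigcup_(j in X) F' z j|].
      left; have [|//|m minj mF'] := IHn (F' z).
        apply: leq_trans (leFn : _ <= n).
        rewrite (bigD1 i) //= [leqRHS](bigD1 i) //=.
        rewrite /F' eqxx (cardsD1 z (F i)) zFi addSn ltnS leq_add2l.
        by apply: leq_sum => j /negPf->.
      exists m => // j; have := mF' j; rewrite /F'.
      by case: eqP => // ->; rewrite inE => /andP[].
    case/forallPn=> X; rewrite -ltnNge => ltX; right; exists X => //.
    apply: contraLR ltX => niX; rewrite -leqNgt.
    rewrite (eq_bigr F) // => j jX; rewrite /F'.
    by case: eqP => // ji; rewrite -ji jX in niX.
  have [//|[X iX ltX]] := IHF x xFi.
  have [//|[Y iY ltY]] := IHF y yFi.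
  set A := \bigcup_(j in X) F' x j in ltX.
  set B := \bigcup_(j in Y) F' y j in ltY.
  (* Since [x != y], the sets [A] and [B] together still cover [F i]; both contain the lists indexed
     by [X :&: Y] without [i]. So [#|A| + #|B|] is at least [#|X| + #|Y| - 1], against [ltX] and
     [ltY]. *)
  have leU : #|X :|: Y| <= #|A :|: B|.
    apply: leq_trans (hallF _) (subset_leq_card _).
    apply/bigcupsP=> j jXY; apply/subsetP=> z zFj; rewrite inE.
    have [eji|nji] := eqVneq j i.
      rewrite eji in zFj; have [ezx|nzx] := eqVneq z x.
        apply/orP; right; apply/bigcupP; exists i => //.
        by rewrite /F' eqxx !inE zFj ezx nxy.
      apply/orP; left; apply/bigcupP; exists i => //.
      by rewrite /F' eqxx !inE zFj nzx.
    case/setUP: jXY => jX; apply/orP; [left|right];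
      by apply/bigcupP; exists j; rewrite // /F' (negPf nji).
  have leI : #|(X :&: Y) :\ i| <= #|A :&: B|.
    apply: leq_trans (hallF _) (subset_leq_card _).
    apply/bigcupsP=> j; rewrite !inE => /and3P[nji jX jY].
    apply/subsetP=> z zFj; rewrite inE.
    by apply/andP; split; apply/bigcupP; exists j; rewrite // /F' (negPf nji).
  have := cardsUI X Y; have := cardsUI A B.
  by move: leI; have := cardsD1 i (X :&: Y); rewrite inE iX iY /=; lia.
have /fin_all_exists[m mF] i : exists y, F i = [set y].
  apply/cards1P; rewrite eqn_leq leqNgt small /=.
  by have := hallF [set i]; rewrite cards1 big_set1.
exists m => [i j eij|i]; last by rewrite mF set11.
apply/eqP; apply: contraT => nij; have := hallF [set i; j].
rewrite cards2 nij leqNgt ltnS /= => /negP[].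
rewrite -(cards1 (m i)); apply/subset_leq_card/bigcupsP=> k.
by rewrite mF sub1set !inE => /orP[] /eqP->; rewrite ?eij.
Qed.

(** * Seeing both colours, and sets closed under common neighbours *)

Definition mixed (T : finType) (e : rel T) (A : {set T}) (f : T -> bool) v :=
  exists y z, [/\ y \in A /\ z \in A, e v y, e v z & f y != f z].

(** For such a [U] every neighbourhood lies inside [U] or misses it, so colourings of [U] and of its
    complement do not interact. *)
Definition common_closed (T : finType) (e : rel T) (U : {set T}) :=
  forall v x y, e v x -> e v y -> x \in U -> y \in U.

(** The condition falls on vertices with a neighbour in [U], not on those in [U]: by closure their
    whole neighbourhood lies in [U]. *)
Definition colourable_part (T : finType) (e : rel T) (U : {set T}) :=
  common_closed e U /\
  exists f, forall v x, e v x -> x \in U -> mixed e U f v.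

Definition triangle (T : finType) (e : rel T) x y z :=
  [&& e x y, e y z & e x z].

Definition four_cycle (T : finType) (e : rel T) x y z w :=
  [&& x != z, y != w, e x y, e x w, e z y & e z w].

Section Cubic.

Variables (T : finType) (e : rel T).
Hypotheses (e_sym : symmetric e) (e_irr : irreflexive e) (e_cub : cubic e).

Implicit Types (A B U : {set T}).

Lemma colourable_partU U U' :
  colourable_part e U -> colourable_part e U' -> colourable_part e (U :|: U').
Proof.
move=> [clU [f fP]] [clU' [f' fP']]; split.
  move=> v x y vx vy; rewrite !inE => /orP[xU|xU'].
    by rewrite (clU v x).
  by rewrite (clU' v x) // orbT.
exists (fun x => if x \in U then f x else f' x) => v x vx.
have [xU _|xU] := boolP (x \in U).
  have [y [z [[yU zU] vy vz fyz]]] := fP _ _ vx xU.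
  by exists y, z; rewrite !inE yU zU.
rewrite inE (negPf xU) /= => xU'.
have [y [z [[yU zU] vy vz fyz]]] := fP' _ _ vx xU'.
have out w : e v w -> w \in U = false.
  by move=> vw; apply: contraNF xU; apply: clU vx.
by exists y, z; rewrite !inE yU zU !orbT !out.
Qed.

(** * Colouring from a four-cycle *)

Lemma card_nbhd_double A B :
  \sum_(v in A) #|nbhd e v :&: B| = \sum_(y in B) #|nbhd e y :&: A|.
Proof.
have cardE v C : #|nbhd e v :&: C| = \sum_(y in C) e v y.
  rewrite -sum1_card big_mkcond [RHS]big_mkcond; apply: eq_bigr => y _.
  by rewrite !inE; do 2!case: ifP => //; case: (e v y).
rewrite (eq_bigr _ (fun v _ => cardE v B)) exchange_big /=.
by apply: eq_bigr => y _; rewrite cardE; apply: eq_bigr => v _; rewrite e_sym.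
Qed.

(* Hall's condition for a set X of vertices other than a and c: at most one
   edge from X ends in b and at most one in d, and the 3 |X| - 2 other edges
   need more than |X| - 1 ends. *)
Lemma four_cycle_matching a b c d :
  four_cycle e a b c d ->
  exists m : T -> T,
    [/\ injective m, forall v, e v (m v), m a = b & m c = d].
Proof.
case/and5P=> nac nbd ab ad /andP[cb cd].
pose F v := if v == a then [set b] else if v == c then [set d]
            else nbhd e v :\: [set b; d].
have Fa : F a = [set b] by rewrite /F eqxx.
have Fc : F c = [set d] by rewrite /F eq_sym (negPf nac) eqxx.
have [X|m minj mF] := @hall _ _ F; last first.
  exists m; split=> //; last 2 first.
  - by have := mF a; rewrite Fa => /set1P.
  - by have := mF c; rewrite Fc => /set1P.
  move=> v; have := mF v; rewrite /F.
  case: eqP => [->|_]; first by move/set1P->.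
  case: eqP => [->|_]; first by move/set1P->.
  by rewrite !inE => /andP[].
set Y := \bigcup_(v in X) F v.
pose X1 := X :\: [set a; c]; pose Y1 := Y :\: [set b; d].
have le_ends : #|X :&: [set a; c]| <= #|Y :&: [set b; d]|.
  rewrite !card_setI2 //; apply: leq_add.
    case aX: (a \in X) => //; rewrite lt0b.
    by apply/bigcupP; exists a; rewrite // Fa set11.
  case cX: (c \in X) => //; rewrite lt0b.
  by apply/bigcupP; exists c; rewrite // Fc set11.
have nbhdX1 y : e a y -> e c y -> #|nbhd e y :&: X1| <= 1.
  move=> ay cy; have := e_cub y; rewrite (cardsD1 a) (cardsD1 c).
  rewrite !inE (e_sym y a) (e_sym y c) ay cy eq_sym nac /=.
  move=> [<-]; apply/subset_leq_card/subsetP=> z.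
  by rewrite !inE negb_or => /and3P[-> /andP[-> ->]].
have upper : \sum_(v in X1) #|nbhd e v :&: [set b; d]| <= 2.
  rewrite card_nbhd_double big_setU1 ?inE //= big_set1.
  by rewrite (leq_add (nbhdX1 _ ab cb) (nbhdX1 _ ad cd)).
have lower : \sum_(v in X1) #|nbhd e v :\: [set b; d]| <= 3 * #|Y1|.
  apply: (@leq_trans (\sum_(v in X1) #|nbhd e v :&: Y1|)).
    apply: leq_sum => v; rewrite !inE negb_or => /andP[/andP[nva nvc] vX].
    apply/subset_leq_card/subsetP=> y yF; have := yF.
    rewrite !inE => /andP[-> ->] /=; apply/bigcupP; exists v => //.
    by rewrite /F (negPf nva) (negPf nvc).
  rewrite card_nbhd_double mulnC -sum_nat_const; apply: leq_sum => y _.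
  by rewrite -(e_cub y) subset_leq_card ?subsetIl.
have total : \sum_(v in X1) #|nbhd e v :&: [set b; d]| +
             \sum_(v in X1) #|nbhd e v :\: [set b; d]| = 3 * #|X1|.
  rewrite -big_split mulnC -sum_nat_const; apply: eq_bigr => v _ /=.
  by rewrite cardsID e_cub.
(* The bounds give 3 |X1| <= 3 |Y1| + 2, hence |X1| <= |Y1| by integrality; [le_ends] accounts for
   the rest of [X]. *)
by have := cardsID [set a; c] X; have := cardsID [set b; d] Y;
  rewrite -/X1 -/Y1; lia.
Qed.

(* Let [r] be the inverse of the matching [m].  A vertex [u] outside the
   coloured set [A] is added, with the colour opposite to that of some [w] in
   [A], whenever [w] is adjacent to [r u].  When this stops, [A] meets only the
   neighbourhoods of the [#|A|] vertices of [r @: A], so it contains them. *)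
Lemma four_cycle_colourable a b c d :
  four_cycle e a b c d ->
  exists2 A : {set T}, b \in A & colourable_part e A.
Proof.
move=> abcd; have [m [minj em ma mc]] := four_cycle_matching abcd.
case/and5P: abcd => nac nbd ab ad /andP[cb cd].
pose r := invF minj.
have mK v : r (m v) = v by apply: invF_f.
have rK u : m (r u) = u by apply: f_invF.
(* As [m (r u) = u], the vertex [r u] is adjacent to [u], so [Q] says that [r u] sees both colours
   for each [u] in [A]. *)
pose Q A := exists f : T -> bool, forall u, u \in A ->
  exists w, [/\ w \in A, e (r u) w & f w != f u].
pose G A := forall u w, u \notin A -> w \in A -> ~~ e (r u) w.
have step A0 : Q A0 -> G A0 \/ exists B : {set T}, Q B /\ A0 \proper B.
  move=> QA0; have [/existsP[u /existsP[w /and3P[uA wA uw]]]|stuck] :=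
    boolP [exists u, exists w, [&& u \notin A0, w \in A0 & e (r u) w]].
    right; exists (u |: A0); split; last first.
      by rewrite properE subsetUr subUset sub1set (negPf uA).
    have [f fP] := QA0; exists (fun x => if x == u then ~~ f w else f x).
    have neq z : z \in A0 -> z == u = false.
      by move=> zA; apply: contraNF uA => /eqP<-.
    move=> z; rewrite !inE => /orP[/eqP->|zA].
      by exists w; rewrite !inE wA orbT uw eqxx neq //; case: (f w).
    have [y [yA zy fyz]] := fP z zA.
    by exists y; rewrite !inE yA orbT zy !neq.
  left=> u w uA wA; apply: contra stuck => uw.
  by apply/existsP; exists u; apply/existsP; exists w; rewrite uA wA.
(* The cycle is the seed: [r b = a] is adjacent to [d], and [r d = c] is adjacent to [b]. *)
have Qbd : Q [set b; d].
  exists (pred1 b) => u; rewrite !inE => /orP[]/eqP->.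
    exists d; rewrite !inE eqxx orbT -ma mK ma ad /= eqxx.
    by rewrite [d == b]eq_sym (negPf nbd).
  exists b; rewrite !inE eqxx -mc mK mc cb /= ?eqxx.
  by rewrite [d == b]eq_sym (negPf nbd).
have [A [bA [f fP] GA]] := maximal_extension step Qbd.
have saturated u : u \in A -> nbhd e (r u) \subset A.
  have cardrA : #|r @: A| = #|A|.
    by apply: card_imset => x y /(congr1 m); rewrite !rK.
  have mrA v : (v \in r @: A) = (m v \in A).
    apply/imsetP/idP => [[x xA ->]|mvA]; first by rewrite rK.
    by exists (m v); rewrite ?mK.
  (* Counted from [A], this sum is [3 * #|A|], so the bound 3 is attained at each of the [#|A|]
     vertices of [r @: A]. *)
  have: \sum_(v in r @: A) #|nbhd e v :&: A| = \sum_(v in r @: A) 3.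
    rewrite card_nbhd_double !sum_nat_const cardrA -sum_nat_const.
    apply: eq_bigr => y yA; rewrite (setIidPl _) ?e_cub //.
    apply/subsetP=> v; rewrite inE mrA => yv; apply: contraT => vA.
    by have := GA _ _ vA yA; rewrite mK e_sym yv.
  have leS v :
      v \in r @: A -> #|nbhd e v :&: A| <= 3 ?= iff (nbhd e v \subset A).
    by have := subset_leqif_cards (subsetIl (nbhd e v) A);
      rewrite eqEsubset subsetIl subsetI subxx e_cub.
  move=> sumE uA; have [_] := leqif_sum leS.
  rewrite sumE eqxx => /esym/forall_inP; apply; exact: imset_f.
exists A; first by rewrite (subsetP bA) // !inE eqxx.
have inA v x : e v x -> x \in A -> m v \in A.
  move=> vx xA; apply: contraT => vA.
  by have := GA _ _ vA xA; rewrite mK vx.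
split=> [v x y vx vy xA|].
  have := saturated _ (inA _ _ vx xA); rewrite mK => /subsetP; apply.
  by rewrite inE.
exists f => v x vx xA; have mvA := inA _ _ vx xA.
have [w [wA vw fw]] := fP _ mvA.
by exists w, (m v); rewrite mK in vw.
Qed.

(** * Short cycles forced by the absence of L *)

Lemma triangle_or_four_cycle x :
  ~ has_L_subgraph e ->
  (exists y z, triangle e x y z) \/ (exists y z w, four_cycle e x y z w).
Proof.
move=> noL.
have [/existsP[y /existsP[z]]|noT] :=
    boolP [exists y, exists z, triangle e x y z].
  by left; exists y, z.
have [/existsP[y /existsP[z /existsP[w]]]|noC] :=
    boolP [exists y, exists z, exists w, four_cycle e x y z w].
  by right; exists y, z, w.
case: noL.
(* A copy of L centred at [x] is built: a leaf equal to a neighbour of [x] would close a triangle,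
   and equal leaves of different branches a four-cycle. *)
have neq_nbhd v : e x v -> x != v.
  by apply: contraTneq => ->; rewrite e_irr.
have neq_triangle v w p : e x v -> e x w -> e v p -> w != p.
  move=> xv xw; apply: contraTneq => <-; apply: contra noT => vw.
  by apply/existsP; exists v; apply/existsP; exists w; rewrite /triangle xv vw.
have neq_cycle v w p q :
    e x v -> e x w -> v != w -> x != p -> e v p -> e w q -> p != q.
  move=> xv xw nvw nxp vp; apply: contraTneq => <-; apply: contra noC => wp.
  apply/existsP; exists v; apply/existsP; exists p; apply/existsP; exists w.
  by rewrite /four_cycle nxp nvw xv xw (e_sym p) vp (e_sym p) wp.
have leaves v : e x v -> exists p q, [/\ x != p, x != q, p != q, e v p & e v q].
  move=> xv; have: 1 < #|nbhd e v :\ x|.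
    by have := e_cub v; rewrite (cardsD1 x) inE e_sym xv; lia.
  case/card_gt1P=> p [q []]; rewrite !inE => /andP[px vp] /andP[qx vq] npq.
  by exists p, q; split; rewrite // eq_sym.
have /card_gt2P[a [b [c [[]]]]] : 2 < #|nbhd e x| by rewrite e_cub.
rewrite !inE => xa xb xc [nab nbc nca].
have [a1 [a2 [xa1 xa2 na aa1 aa2]]] := leaves _ xa.
have [b1 [b2 [xb1 xb2 nb bb1 bb2]]] := leaves _ xb.
have [c1 [c2 [xc1 xc2 nc cc1 cc2]]] := leaves _ xc.
(* The order is the numbering of [L_adj]: centre, neighbours, then leaves in pairs. *)
pose s := [:: x; a; b; c; a1; a2; b1; b2; c1; c2].
have nac : a != c by rewrite eq_sym.
have s_uniq : uniq s.
  rewrite /= !inE !negb_or -!andbA.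
  do !(apply/andP; split) => //; eauto 2.
have s_edge i j : L_edge0 i j -> e (nth x s i) (nth x s j).
  rewrite /L_edge0 -!orbA.
  by case/or4P=> /andP[/eqP->]; [case/or3P | case/orP..] => /eqP->.
exists (fun i => nth x s i); split=> [i j /eqP|i j /orP[/s_edge //|/s_edge]].
  by rewrite nth_uniq // => /eqP/val_inj.
by rewrite e_sym.
Qed.

(** * A region of triangles without four-cycles *)

Section Triangles.

Variable W : {set T}.
Hypotheses (W_closed : common_closed e W)
  (W_triangle : forall x, x \in W -> exists y z, triangle e x y z)
  (W_no_cycle : forall x y z w, x \in W -> ~~ four_cycle e x y z w).

(** In a triangle [x], [p], [q], the vertices [x] and [p] share the neighbour [q], while [p] and [y]
    share [x]. *)
Lemma W_nbhd x y : x \in W -> e x y -> y \in W.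
Proof.
move=> xW xy; have [p [q /and3P[xp pq xq]]] := W_triangle xW.
have pW : p \in W by apply: (W_closed (v := q)) xW; rewrite e_sym.
by apply: (W_closed (v := x)) pW.
Qed.

Lemma triangleC x y z : triangle e x y z = triangle e x z y.
Proof. by rewrite /triangle (e_sym z y) andbCA andbA andbC andbA. Qed.

Lemma triangle_rot x y z : triangle e x y z = triangle e y z x.
Proof.
by rewrite /triangle (e_sym z x) (e_sym y x); apply/and3P/and3P=> -[].
Qed.

(** Only three neighbours are available at [x], so two triangles there share an edge; if they
    differ, their other edges form a four-cycle. *)
Lemma triangle_unique x y z p q :
  x \in W -> triangle e x y z -> triangle e x p q -> p \in [set y; z].
Proof.
move=> xW /and3P[xy yz xz] /and3P[xp pq xq]; apply: contraT.
rewrite !inE negb_or => /andP[npy npz].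
have neq v w : e v w -> v != w by apply: contraTneq => ->; rewrite e_irr.
have: q \in [set y; z].
  have /eqP : [set p; y; z] == nbhd e x.
    rewrite eqEcard e_cub subUset subUset !sub1set !inE xp xy xz /=.
    by rewrite -setUA cardsU1 cards2 !inE (negPf npy) (negPf npz) (neq _ _ yz).
  move/setP/(_ q); rewrite !inE xq; case: eqP => // eqp.
  by rewrite eqp e_irr in pq.
rewrite !inE => /orP[]/eqP eq_q; subst q.
  have := W_no_cycle p y z xW.
  by rewrite /four_cycle (neq _ _ xy) npz xp xz (e_sym y) pq yz.
have := W_no_cycle p z y xW.
by rewrite /four_cycle (neq _ _ xz) npy xp xy (e_sym z) pq (e_sym z) yz.
Qed.

Definition triangle_closed A :=
  forall x y z, x \in A -> triangle e x y z -> y \in A.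

Lemma triangle_closed1 x y z :
  x \in W -> triangle e x y z -> triangle_closed [set x; y; z].
Proof.
move=> xW xyz; have /and3P[xy _ xz] := xyz.
have yW := W_nbhd xW xy; have zW := W_nbhd xW xz.
have yzx : triangle e y z x by rewrite -triangle_rot.
have zxy : triangle e z x y by rewrite -triangle_rot.
move=> v p q; rewrite !inE -orbA => /or3P[]/eqP->.
- by move/(triangle_unique xW xyz); rewrite !inE => /orP[]->; rewrite ?orbT.
- by move/(triangle_unique yW yzx); rewrite !inE => /orP[]->; rewrite ?orbT.
- by move/(triangle_unique zW zxy); rewrite !inE => /orP[]->; rewrite ?orbT.
Qed.

Lemma mixed_ext A B f g v :
  A \subset B -> {in A, f =1 g} -> mixed e A f v -> mixed e B g v.
Proof.
move=> /subsetP AB fg [y [z [[yA zA] vy vz fyz]]].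
by exists y, z; rewrite -!fg // !AB.
Qed.

(* Colour [y] like its neighbour [x] and the two other vertices of its triangle
   with the opposite colour. *)
Lemma add_triangle A f x y :
  triangle_closed A -> A \subset W -> x \in A -> y \notin A -> e x y ->
  (forall v, v \in A -> mixed e A f v \/
     v = x /\ exists z, [/\ z \in A, e x z & f z != f x]) ->
  exists B g, [/\ triangle_closed B, B \subset W, A \proper B &
    forall v, v \in B -> mixed e B g v].
Proof.
move=> clA AW xA yA xy fP.
have yW : y \in W by apply: W_nbhd xy; apply: (subsetP AW).
have [p [q ypq]] := W_triangle yW; have /and3P[yp pq yq] := ypq.
have pA : p \notin A.
  apply: contra yA => /clA; apply.
  by rewrite triangleC -triangle_rot; exact: ypq.
have qA : q \notin A.
  by apply: contra yA => /clA; apply; rewrite triangle_rot; exact: ypq.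
pose B := A :|: [set y; p; q].
pose g v := if v \in A then f v else if v == y then f x else ~~ f x.
have [yB pB qB] : [/\ y \in B, p \in B & q \in B].
  by rewrite !inE !eqxx !orbT.
have AB : A \subset B by apply: subsetUl.
have xB := subsetP AB _ xA.
have neq v : e y v -> v == y = false.
  by apply: contraTF => /eqP->; rewrite e_irr.
have gx : g x = f x by rewrite /g xA.
have gy : g y = f x by rewrite /g (negPf yA) eqxx.
have gp : g p = ~~ f x by rewrite /g (negPf pA) neq.
have gq : g q = ~~ f x by rewrite /g (negPf qA) neq.
have nf (b : bool) : b != ~~ b by case: b.
exists B, g; split.
- move=> v w z; rewrite !in_setU => /orP[vA vwz|vt vwz].
    by rewrite (clA v w z).
  apply/orP; right; rewrite -!in_setU.
    by apply: (triangle_closed1 yW ypq) vwz; rewrite !in_setU.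
- rewrite subUset AW; apply/subsetP=> v; rewrite !inE -orbA.
  by case/or3P=> /eqP-> //; [apply: W_nbhd yp | apply: W_nbhd yq].
- by rewrite properE AB; apply/subsetPn; exists y.
move=> v; rewrite !inE -orbA => /orP[vA|].
  (* The exceptional [x] may still lack a neighbour of its own colour; [y] is one. *)
  have [|[-> [z [zA xz fz]]]] := fP v vA.
    by apply: mixed_ext => // z zA; rewrite /g zA.
  by exists y, z; rewrite gy /g zA eq_sym yB (subsetP AB).
case/or3P=> /eqP->.
- by exists x, p; rewrite gx gp e_sym.
- by exists y, q; rewrite gy gq e_sym.
- by exists y, p; rewrite gy gp e_sym (e_sym q).
Qed.

Lemma triangles_colourable u :
  u \in W -> exists2 A : {set T}, u \in A & colourable_part e A.
Proof.
move=> uW; have [b [c ubc]] := W_triangle uW; have /and3P[ub bc uc] := ubc.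
(* Within the first triangle [b] and [c] see both colours but [u] only one. Adding the triangle of
   the third neighbour [u'] repairs [u], by the exceptional case of [add_triangle]. *)
pose A0 := [set u; b; c]; pose f0 v := v == u.
pose Q A := triangle_closed A /\ A \subset W /\
  exists f, forall v, v \in A -> mixed e A f v.
have [uA0 bA0 cA0] : [/\ u \in A0, b \in A0 & c \in A0].
  by rewrite !inE !eqxx !orbT.
have neq v : e u v -> v == u = false.
  by apply: contraTF => /eqP->; rewrite e_irr.
have [u' uu' u'A0] : exists2 u', e u u' & u' \notin A0.
  have : 0 < #|nbhd e u :\: A0|.
    rewrite cardsD e_cub subn_gt0.
    apply: (@leq_ltn_trans #|[set b; c]|); last by rewrite cards2; case: eqP.
    apply/subset_leq_card/subsetP=> v; rewrite !inE => /andP[uv].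
    by rewrite neq.
  by case/card_gt0P=> v; rewrite !inE => /andP[? ?]; exists v; rewrite // !inE.
have [A1 [f1 [clA1 A1W /properP[A01 _] fP1]]] :
    exists B g, [/\ triangle_closed B, B \subset W, A0 \proper B &
      forall v, v \in B -> mixed e B g v].
  apply: (@add_triangle A0 f0 u u') => //.
  - exact: triangle_closed1.
  - rewrite !subUset !sub1set uW.
    by apply/andP; split; [apply: W_nbhd ub | apply: W_nbhd uc].
  move=> v; rewrite !inE -orbA => /or3P[]/eqP->.
  - by right; split=> //; exists b; rewrite /f0 eqxx neq.
  - by left; exists u, c; rewrite /f0 eqxx neq // e_sym.
  - by left; exists u, b; rewrite /f0 eqxx neq // e_sym (e_sym c).
(* Growth stops at a union of connected components. *)
pose G A := forall x y, x \in A -> e x y -> y \in A.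
have step A : Q A -> G A \/ exists B : {set T}, Q B /\ A \proper B.
  move=> [clA [AW [f fP]]].
  have [/existsP[x /existsP[y /and3P[xA xy yA]]]|stuck] :=
      boolP [exists x, exists y, [&& x \in A, e x y & y \notin A]].
    have [|B [g [clB BW ltAB gP]]] := add_triangle (f := f) clA AW xA yA xy.
      by move=> v vA; left; apply: fP.
    by right; exists B; split=> //; split=> //; split=> //; exists g.
  left=> x y xA xy; apply: contraNT stuck => yA.
  by apply/existsP; exists x; apply/existsP; exists y; rewrite xA xy.
have QA1 : Q A1 by split=> //; split=> //; exists f1.
have [A [A1A [_ [_ [f fP]]] GA]] := maximal_extension step QA1.
exists A; first by rewrite (subsetP A1A) // (subsetP A01).
split=> [v x y vx vy xA|].
  by apply: (GA v) vy; apply: (GA x) xA _; rewrite e_sym.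
by exists f => v x vx xA; apply: fP; apply: GA xA _; rewrite e_sym.
Qed.

End Triangles.

End Cubic.

(** * Exhausting the vertex set by colourable parts *)

Theorem theorem2p1 (T : finType) (e : rel T) :
  simple_graph e -> cubic e -> ~ has_L_subgraph e ->
  exists S1 S2 : {set T},
    [/\ S1 :&: S2 = set0, S1 :|: S2 = setT,
        total_dominating e S1 & total_dominating e S2].
Proof.
move=> [e_sym e_irr] e_cub noL.
have step U : colourable_part e U ->
    U = setT \/ exists B : {set T}, colourable_part e B /\ U \proper B.
  move=> colU; have [->|nUT] := eqVneq U setT; [by left | right].
  have /subsetPn[u _ uU] : ~~ ([set: T] \subset U).
    by rewrite subTset.
  suff [A [v vA vU] colA] :
      exists2 A : {set T}, (exists2 v, v \in A & v \notin U) &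
        colourable_part e A.
    exists (U :|: A); split; first exact: colourable_partU.
    rewrite properE subsetUl; apply/subsetPn; exists v => //.
    by rewrite inE vA orbT.
  (* The second place is used because [four_cycle_colourable] puts that vertex in its set, which
     thus leaves [U]. *)
  pose cyclic b := [exists a, exists c, exists d, four_cycle e a b c d].
  have [/existsP[b /andP[bU /existsP[a /existsP[c /existsP[d abcd]]]]]|noC] :=
      boolP [exists b, (b \notin U) && cyclic b].
    have [A bA colA] := four_cycle_colourable e_sym e_cub abcd.
    by exists A => //; exists b.
  have no_cycle x y z w : x \in ~: U -> ~~ four_cycle e x y z w.
    rewrite inE => xU; apply: contra noC => /and5P[nxz nyw xy xw /andP[zy zw]].
    apply/existsP; exists x; rewrite xU.
    apply/existsP; exists y; apply/existsP; exists w; apply/existsP; exists z.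
    by rewrite /four_cycle nyw nxz !(e_sym y) !(e_sym w) xy zy xw.
  have closedC : common_closed e (~: U).
    move=> v x y vx vy; rewrite !inE; apply: contra => yU.
    by case: colU => clU _; apply: clU vx yU.
  have triC x : x \in ~: U -> exists y z, triangle e x y z.
    move=> xU.
    case: (triangle_or_four_cycle e_sym e_irr e_cub x noL) => // -[y [z [w]]].
    by rewrite (negPf (no_cycle _ _ _ _ xU)).
  have uUC : u \in ~: U by rewrite inE.
  have [A uA colA] :=
    triangles_colourable e_sym e_irr e_cub closedC triC no_cycle uUC.
  by exists A => //; exists u.
have col0 : colourable_part e set0.
  by split=> [v x y _ _|]; [rewrite inE | exists predT => v x _; rewrite inE].
have [B [_ [_ [f fP]] eqB]] := maximal_extension step col0; subst B.
have {}fP v : mixed e setT f v.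
  have /card_gt0P[x] : 0 < #|nbhd e v| by rewrite e_cub.
  by rewrite inE => vx; apply: fP vx _; rewrite inE.
exists [set x | f x], [set x | ~~ f x]; split.
- by apply/setP=> x; rewrite !inE andbN.
- by apply/setP=> x; rewrite !inE orbN.
- move=> v; have [y [z [_ vy vz]]] := fP v.
  by case fy: (f y); case fz: (f z) => // _; [exists y | exists z];
    rewrite ?inE.
- move=> v; have [y [z [_ vy vz]]] := fP v.
  by case fy: (f y); case fz: (f z) => // _; [exists z | exists y];
    rewrite ?inE ?fy ?fz.
Qed.
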